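(* Let $n$ be a nonnegative integer and let $a,b,c$ be complex numbers such that no lower parameter of the series below is a nonpositive integer and all denominators below are nonzero. Then $${}_5F_4\left[\begin{matrix}-\frac n2,\ \frac{1-n}{2},\ 1+\frac{c+bn}{1-2b},\ -a,\ a\\ \frac12,\ \frac{c+bn}{1-2b},\ c+1,\ 1-c-n\end{matrix};1\right]=\frac{c(c+a+bn)}{2(c+bn)(a+c)}\,\frac{(c+a)_n}{(c)_n}+\frac{c(c-a+bn)}{2(c+bn)(c-a)}\,\frac{(c-a)_n}{(c)_n}.$$
   Context: $(x)_0=1$ and $(x)_n=x(x+1)\cdots(x+n-1)$ for $n\ge1$. The generalized hypergeometric series is ${}_pF_q\left[\begin{matrix}a_1,\dots,a_p\\ b_1,\dots,b_q\end{matrix};z\right]=\sum_{k\ge0}\frac{(a_1)_k\cdots(a_p)_k}{(b_1)_k\cdots(b_q)_k}\frac{z^k}{k!}$, with lower parameters $b_j\in\mathbb{C}\setminus\mathbb{Z}_{\le0}$. The series involved terminates. *)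

(* Defs.v *)
From mathcomp Require Import all_boot all_order all_algebra.
From mathcomp Require Import complex.
From mathcomp Require Import all_classical all_reals all_analysis.
Set Implicit Arguments.
Unset Strict Implicit.
Unset Printing Implicit Defensive.

Import Order.TTheory GRing.Theory Num.Theory.
Import numFieldNormedType.Exports.

Local Open Scope ring_scope.

Section Hypergeometric.
Context {F : numFieldType}.

Definition poch (x : F) (n : nat) : F := \prod_(i < n) (x + i%:R).

Definition pFq_term (us ls : seq F) (z : F) (k : nat) : F :=
  (\prod_(u <- us) poch u k) / (\prod_(l <- ls) poch l k) * (z ^+ k / k`!%:R).

(* Sum of the series in the norm topology of [F]; [limn] is total, so this is
   meaningful only when the partial sums converge, e.g. when the series
   terminates. *)
Definition pFq (us ls : seq F) (z : F) : F :=
  limn (series (pFq_term us ls z)).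

Definition nonpos_int (x : F) : Prop := exists m : nat, x = - m%:R.

End Hypergeometric.

(* Main.v *)
Require Import Defs.
From mathcomp Require Import all_boot all_order all_algebra.
From mathcomp Require Import complex.
From mathcomp Require Import all_classical all_reals all_analysis.
From mathcomp Require Import ring zify.
Import Order.TTheory GRing.Theory Num.Theory.
Import numFieldNormedType.Exports.
Local Open Scope ring_scope.

(** The quadratic pair of upper parameters makes the series a sum over even
    binomial coefficients, because
    (-n/2)_k ((1-n)/2)_k = 'C(n, 2k) (1/2)_k k!.  The pair d + 1 over d, with
    d = (c + bn)/(1 - 2b), contributes (c + k + b(n - 2k))/(c + bn), which is
    affine in b.  With P_k(a) = prod_(j < k) (a^2 - j^2), the k-th term is
    therefore c/((c + bn)(c)_n) times
      P_k(a) ('C(n, 2k) (c+k)_(n-2k) + b n 'C(n-1, 2k) (c+1+k)_(n-1-2k)).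
    Both parts are instances, at (n, c) and at (n-1, c+1), of the identity
      sum_k 'C(n, 2k) (c+k)_(n-2k) P_k(a) = ((c+a)_n + (c-a)_n)/2
    ([stirling_sum_poch]).  This is Stirling's central-difference interpolation
    of the even part of a |-> (c+a)_n: the even central differences of (c+a)_n
    at 0 are n!/(n-2k)! (c+k)_(n-2k), and the P_k are the even central
    factorials.  It is proved here by checking that both sides satisfy
      x_(n+2) = (2c + 2n + 1) x_(n+1) - ((c+n)^2 - a^2) x_n. *)

Section RisingFactorial.
Context {F : numFieldType}.
Implicit Types (a b c d x : F) (n m k N : nat).

(** * Rising factorials *)

Lemma poch0 x : poch x 0 = 1.
Proof. by rewrite /poch big_ord0. Qed.

Lemma pochS x n : poch x n.+1 = poch x n * (x + n%:R).
Proof. by rewrite /poch big_ord_recr. Qed.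

Lemma pochD x m n : poch x (m + n) = poch x m * poch (x + m%:R) n.
Proof.
elim: n => [|n IH]; first by rewrite addn0 poch0 mulr1.
by rewrite addnS !pochS IH natrD; ring.
Qed.

Lemma pochSl x n : poch x n.+1 = x * poch (x + 1) n.
Proof. by rewrite -add1n pochD pochS poch0 mul1r addr0. Qed.

Lemma poch_neq0 x n : ~ nonpos_int x -> poch x n != 0.
Proof.
move=> x_int; apply/prodf_neq0 => i _; apply/eqP => /eqP.
by rewrite addr_eq0 => /eqP xE; apply: x_int; exists i.
Qed.

(** Negate every factor and reverse their order. *)
Lemma poch_reflect x n : poch (1 - x - n%:R) n = (-1) ^+ n * poch x n.
Proof.
elim: n x => [|n IH] x; first by rewrite !poch0 expr0 mulr1.
rewrite pochSl (_ : 1 - x - n.+1%:R + 1 = 1 - x - n%:R); last first.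
  by rewrite -natr1; ring.
by rewrite IH pochS exprS -natr1; ring.
Qed.

Lemma poch_reflect_sub c n k : (k <= n)%N ->
  poch (1 - c - n%:R) k * poch c (n - k) = (-1) ^+ k * poch c n.
Proof.
move=> le_kn; rewrite -{3}(subnK le_kn) pochD.
have -> : 1 - c - n%:R = 1 - (c + (n - k)%:R) - k%:R.
  by rewrite -{1}(subnK le_kn) natrD; ring.
by rewrite poch_reflect; ring.
Qed.

Lemma poch_ratio d k : ~ nonpos_int d ->
  poch (1 + d) k / poch d k = (d + k%:R) / d.
Proof.
move=> d_int; have d0 : d != 0.
  by have := poch_neq0 _ 1 d_int; rewrite pochS poch0 mul1r addr0.
apply/eqP; rewrite eqr_div ?poch_neq0 //; apply/eqP.
by rewrite [1 + d]addrC mulrC -pochSl pochS mulrC.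
Qed.

Lemma poch_opp a k :
  poch (- a) k * poch a k = (-1) ^+ k * \prod_(j < k) (a ^+ 2 - j%:R ^+ 2).
Proof.
elim: k => [|k IH]; first by rewrite !poch0 big_ord0 mulr1.
rewrite !pochS big_ord_recr exprS /=.
transitivity ((poch (- a) k * poch a k) * ((- a + k%:R) * (a + k%:R))).
  by ring.
by rewrite IH; ring.
Qed.

(** * Binomial coefficients in the field *)

(** The factor n - j is the untruncated difference; for j >= n both sides
    vanish. *)
Lemma natr_mul_bin_left n j :
  (j.+1%:R : F) * 'C(n, j.+1)%:R = (n%:R - j%:R) * 'C(n, j)%:R.
Proof.
have [le_jn|lt_nj] := leqP j n.
  by rewrite -natrB // -!natrM mul_bin_left.
by rewrite !bin_small ?mulr0 // ltnW.
Qed.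

(** Doubling: with m = 2k, these are (-n)_m / 4^k on the left and
    m! / 4^k = (1/2)_k k! on the right, and (-n)_m = 'C(n, m) m!. *)
Lemma poch_half_bin n k :
  poch (- (n%:R / 2)) k * poch ((1 - n%:R) / 2) k
  = 'C(n, k.*2)%:R * poch (1 / 2) k * (k`!%:R : F).
Proof.
elim: k => [|k IH]; first by rewrite !poch0 bin0 fact0; ring.
rewrite doubleS factS natrM !pochS.
transitivity ((poch (- (n%:R / 2)) k * poch ((1 - n%:R) / 2) k)
  * ((- (n%:R / 2) + k%:R) * ((1 - n%:R) / 2 + k%:R) : F)); first by ring.
rewrite IH.
have E1 := natr_mul_bin_left n k.*2; have E2 := natr_mul_bin_left n k.*2.+1.
have -> : ('C(n, k.*2.+2)%:R : F) =
  (n%:R - k.*2.+1%:R) * ((n%:R - k.*2%:R) * 'C(n, k.*2)%:R)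
    / (k.*2.+2%:R * k.*2.+1%:R).
  apply: canRL (mulfK _) _; first by rewrite mulf_neq0 ?pnatr_eq0.
  by rewrite -E1 [RHS]mulrCA -E2; ring.
rewrite -!natr1 -muln2 natrM; field.
by rewrite -natrM !natr1 !pnatr_eq0.
Qed.

(** * Stirling interpolation of the even part of the rising factorial *)

(** The cut-off N is independent of n, since the recurrence relates sums for
    three values of n; every N > n/2 gives the same sum. *)
Definition stirling_sum a c n N : F :=
  \sum_(k < N) 'C(n, k.*2)%:R * poch (c + k%:R) (n - k.*2)
    * \prod_(j < k) (a ^+ 2 - j%:R ^+ 2).

Lemma stirling_sum_stable a c n N : (n < N.*2)%N ->
  stirling_sum a c n N.+1 = stirling_sum a c n N.
Proof.
by move=> lt_nN; rewrite /stirling_sum big_ord_recr /= bin_small // !mul0r addr0.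
Qed.

(** This is the coefficient of P_(k+1)(a) in the three-term recurrence for
    [stirling_sum]; the last summand and the square of k + 1 come from
    a^2 P_k = P_(k+1) + k^2 P_k.  Dividing out the common factors of the rising
    factorials leaves an identity between neighbouring binomial coefficients. *)
Lemma stirling_coef_rec c n k (x := c + k.+1%:R) :
  'C(n.+2, k.+1.*2)%:R * poch x (n.+2 - k.+1.*2)
  = (2 * c + 2 * n%:R + 1) * ('C(n.+1, k.+1.*2)%:R * poch x (n.+1 - k.+1.*2))
    - ((c + n%:R) ^+ 2 - k.+1%:R ^+ 2)
        * ('C(n, k.+1.*2)%:R * poch x (n - k.+1.*2))
    + 'C(n, k.*2)%:R * poch (c + k%:R) (n - k.*2).
Proof.
rewrite {}/x !doubleS !subSS.
have [lt_nk|le_kn] := ltnP n k.*2.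
  by rewrite !bin_small //; [ring|lia..].
have [->|neq_nk] := eqVneq n k.*2.
  by rewrite subnn !poch0 !binn !bin_small //; ring.
have lt_kn : (k.*2 < n)%N by rewrite ltn_neqAle eq_sym neq_nk.
have [->|neq_nk1] := eqVneq n k.*2.+1.
  rewrite subSn // subnn subnn !pochS !poch0 !binn [in RHS]bin_small // binSn.
  by rewrite binSn -!natr1 -mul2n natrM; ring.
have [m def_n] : exists m, n = (k.*2.+2 + m)%N.
  by exists (n - k.*2.+2)%N; rewrite subnKC //; lia.
have -> : (n - k.*2 = m.+2)%N by lia.
have -> : (n - k.*2.+1 = m.+1)%N by lia.
have -> : (n - k.*2.+2 = m)%N by lia.
rewrite [poch (c + k%:R) _]pochSl.
rewrite (_ : c + k%:R + 1 = c + k.+1%:R); last by rewrite -natr1; ring.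
rewrite !pochS !binS !natrD.
have En : (n%:R : F) = 2 * k%:R + 2 + m%:R.
  by rewrite def_n natrD -!natr1 -mul2n natrM; ring.
(* After Pascal's rule the identity is a combination of the absorption relation
   between the two lowest binomial coefficients. *)
have := natr_mul_bin_left n k.*2; rewrite En -!natr1 -mul2n natrM => absorb.
rewrite mul2n in absorb *.
apply/subr0_eq; move/eqP: absorb; rewrite -subr_eq0 => /eqP absorb.
rewrite -(mulr0 (- poch (c + (k%:R + 1)) m * (c + (k%:R + 1) + m%:R))) -absorb.
by ring.
Qed.

Lemma stirling_sum_rec a c n N : (n < N.*2)%N ->
  stirling_sum a c n.+2 N.+1
  = (2 * c + 2 * n%:R + 1) * stirling_sum a c n.+1 N.+1
    - ((c + n%:R) ^+ 2 - a ^+ 2) * stirling_sum a c n N.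
Proof.
move=> lt_nN; have := stirling_sum_stable a c n N lt_nN.
rewrite /stirling_sum.
set P := fun k => \prod_(j < k) (a ^+ 2 - j%:R ^+ 2).
set t := fun (n k : nat) => 'C(n, k.*2)%:R * poch (c + k%:R) (n - k.*2).
rewrite -[LHS]/(\sum_(k < N.+1) t n k * P k) => stable.
rewrite -[LHS]/(\sum_(k < N.+1) t n.+2 k * P k).
rewrite -[X in _ = _ * X - _]/(\sum_(k < N.+1) t n.+1 k * P k).
rewrite -[X in _ = _ - _ * X]/(\sum_(k < N) t n k * P k).
(* Multiplication by a^2 shifts the central factorials:
   a^2 P_k = P_(k+1) + k^2 P_k. *)
have a2P : a ^+ 2 * (\sum_(k < N) t n k * P k)
    = \sum_(k < N) t n k * P k.+1 + \sum_(k < N.+1) k%:R ^+ 2 * (t n k * P k).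
  have tN0 : t n N = 0 by rewrite /t bin_small ?mul0r.
  rewrite [X in _ + X]big_ord_recr /= tN0 mul0r mulr0 addr0.
  rewrite -big_split mulr_sumr; apply: eq_bigr => k _ /=.
  by rewrite /P big_ord_recr /=; ring.
rewrite mulrBl a2P -[X in _ - (_ * X - _)]stable opprB.
rewrite [LHS]big_ord_recl [X in _ = _ * X + _]big_ord_recl.
rewrite [X in _ = _ + (_ - _ * X)]big_ord_recl [X in _ + X - _]big_ord_recl /=.
rewrite expr0n mul0r add0r.
have -> : t n.+2 0%N = (2 * c + 2 * n%:R + 1) * t n.+1 0%N
    - (c + n%:R) ^+ 2 * t n 0%N.
  by rewrite /t !double0 !bin0 !subn0 !pochS -natr1; ring.
have -> : \sum_(i < N) t n.+2 (bump 0 i) * P (bump 0 i) =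
  (2 * c + 2 * n%:R + 1) * (\sum_(i < N) t n.+1 (bump 0 i) * P (bump 0 i))
  - (c + n%:R) ^+ 2 * (\sum_(i < N) t n (bump 0 i) * P (bump 0 i))
  + \sum_(i < N) (bump 0 i)%:R ^+ 2 * (t n (bump 0 i) * P (bump 0 i))
  + \sum_(i < N) t n i * P i.+1.
  rewrite !mulr_sumr -sumrB -!big_split; apply: eq_bigr => k _ /=.
  by rewrite /bump add1n /t stirling_coef_rec; ring.
by ring.
Qed.

(** Both sides satisfy the same three-term recurrence in n; for the right-hand
    side each of (c + a)_n and (c - a)_n satisfies it, by
    (c + n + 1 + a) = (2c + 2n + 1) - (c + n - a). *)
Lemma stirling_sum_poch a c n N : (n < N.*2)%N ->
  2 * stirling_sum a c n N = poch (c + a) n + poch (c - a) n.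
Proof.
elim/ltn_ind: n N => -[|[|n]] IH [//|N] lt_nN.
- rewrite /stirling_sum big_ord_recl [X in _ + X]big1 => [|k _]; last first.
    by rewrite bin_small ?mul0r.
  by rewrite big_ord0 bin0 !poch0; ring.
- rewrite /stirling_sum big_ord_recl [X in _ + X]big1 => [|k _]; last first.
    by rewrite bin_small ?mul0r //= /bump; lia.
  by rewrite /= big_ord0 bin0 subn0 !pochS !poch0; ring.
have lt_nN' : (n < N.*2)%N by move: lt_nN; rewrite doubleS; lia.
rewrite stirling_sum_rec // mulrBr !(mulrCA 2) !IH //; last exact: ltnW.
by rewrite !pochS -natr1; ring.
Qed.

(** * The terminating series *)

Lemma pFq_finite (us ls : seq F) (z : F) N :
  (forall k, (N <= k)%N -> pFq_term us ls z k = 0) ->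
  pFq us ls z = \sum_(k < N) pFq_term us ls z k.
Proof.
move=> term0; rewrite /pFq; apply/(cvg_lim (@norm_hausdorff _ _)).
apply: cvg_near_cst; near=> m.
have le_Nm : (N <= m)%N by near: m; exact: nbhs_infty_ge.
rewrite /series /= (big_cat_nat (n := N)) //= big_mkord.
rewrite [X in _ + X]big_nat_cond [X in _ + X]big1 ?addr0 // => k.
by case/andP => /andP[/term0].
Unshelve. all: by end_near. Qed.

(** Each term, once multiplied out, is affine in b; both coefficients have the
    shape of a summand of [stirling_sum], the second with n - 1 and c + 1. *)
Lemma summand_split c b n k : c + k%:R != 0 ->
  (c + k%:R + b * (n%:R - k.*2%:R)) / (c + k%:R)
    * ('C(n, k.*2)%:R * poch (c + k%:R) (n - k.*2))
  = 'C(n, k.*2)%:R * poch (c + k%:R) (n - k.*2)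
    + b * n%:R * ('C(n.-1, k.*2)%:R * poch (c + 1 + k%:R) (n.-1 - k.*2)).
Proof.
move=> ck0; set X := _ * poch _ _.
have -> : (c + k%:R + b * (n%:R - k.*2%:R)) / (c + k%:R) * X
    = X + b * ((n%:R - k.*2%:R) * X / (c + k%:R)) by field.
rewrite -[b * n%:R * _]mulrA; congr (_ + b * _); rewrite {}/X.
have [lt_kn|le_nk] := ltnP k.*2 n; last first.
  have [->|neq_nk] := eqVneq n k.*2; last by rewrite !bin_small; [ring|lia..].
  case: (k.*2) => [|j]; first by rewrite subrr !mul0r.
  by rewrite subrr !mul0r [_.-1]/= bin_small // mul0r mulr0.
case: n lt_kn => // n lt_kn; rewrite subSn //= pochSl.
rewrite (_ : c + 1 + k%:R = c + k%:R + 1); last by ring.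
have -> : n.+1%:R * ('C(n, k.*2)%:R * poch (c + k%:R + 1) (n - k.*2))
  = ((n.+1%:R - k.*2%:R) * 'C(n.+1, k.*2)%:R) * poch (c + k%:R + 1) (n - k.*2).
  by rewrite mulrA -natrB 1?ltnW // -!natrM mul_bin_down.
by field.
Qed.

(** The reflection (1 - c - n)_k (c)_(n-k) = (-1)^k (c)_n moves the last lower
    parameter to the numerator, its sign cancels that of
    (-a)_k (a)_k = (-1)^k P_k(a), and (c)_(n-k) = (c)_k (c+k)_(n-2k) leaves
    the summands of [stirling_sum].  All this needs 2k <= n; beyond that the
    binomial coefficients are 0. *)
Lemma pFq_term_summand a b c n k (d := (c + b * n%:R) / (1 - 2 * b)) :
  (forall l, l \in [:: 1 / 2; d; c + 1; 1 - c - n%:R] -> ~ nonpos_int l) ->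
  1 - 2 * b != 0 -> c + b * n%:R != 0 -> c != 0 -> poch c n != 0 ->
  pFq_term [:: - (n%:R / 2); (1 - n%:R) / 2; 1 + d; - a; a]
           [:: 1 / 2; d; c + 1; 1 - c - n%:R] 1 k
  = c / ((c + b * n%:R) * poch c n)
    * ('C(n, k.*2)%:R * poch (c + k%:R) (n - k.*2)
         * \prod_(j < k) (a ^+ 2 - j%:R ^+ 2)
       + b * n%:R * ('C(n.-1, k.*2)%:R * poch (c + 1 + k%:R) (n.-1 - k.*2)
         * \prod_(j < k) (a ^+ 2 - j%:R ^+ 2))).
Proof.
move=> h_lower b0 cbn0 c0 cn0.
have half_int : ~ nonpos_int (1 / 2 : F) by apply: h_lower; rewrite !inE eqxx.
have d_int : ~ nonpos_int d by apply: h_lower; rewrite !inE eqxx orbT.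
have c1_int : ~ nonpos_int (c + 1) by apply: h_lower; rewrite !inE eqxx !orbT.
have cn_int : ~ nonpos_int (1 - c - n%:R).
  by apply: h_lower; rewrite !inE eqxx !orbT.
have fact_neq0 : (k`!%:R : F) != 0 by rewrite pnatr_eq0 -lt0n fact_gt0.
rewrite /pFq_term !big_cons !big_nil !mulr1 expr1n [_ * (_ * (_ * _))]mulrA.
rewrite poch_half_bin.
have [lt_nk|le_kn] := ltnP n k.*2.
  by rewrite !bin_small ?(leq_ltn_trans (leq_pred n)) //; ring.
have pcS : c * poch (c + 1) k = poch c k * (c + k%:R).
  by rewrite -pochSl pochS.
have [pck0 ck0] : poch c k != 0 /\ c + k%:R != 0.
  by apply/andP; rewrite -negb_or -mulf_eq0 -pcS mulf_neq0 ?poch_neq0.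
have refl := poch_reflect_sub c n k.
have le_kn' : (k <= n)%N by lia.
have pcD : poch c (n - k) = poch c k * poch (c + k%:R) (n - k.*2).
  by rewrite -pochD; congr poch; lia.
have pck'0 : poch (c + k%:R) (n - k.*2) != 0.
  have := cn0; rewrite -{1}(subnK le_kn') pochD pcD !mulf_eq0 !negb_or.
  by case/andP => /andP[].
have c1E : poch (c + 1) k = poch c k * (c + k%:R) / c by rewrite -pcS mulrC mulKf.
have cnE : poch (1 - c - n%:R) k = (-1) ^+ k * poch c n / poch c (n - k).
  by rewrite -refl // mulfK // pcD mulf_neq0.
transitivity ('C(n, k.*2)%:R * (poch (1 + d) k / poch d k)
    * (poch (- a) k * poch a k) / (poch (c + 1) k * poch (1 - c - n%:R) k)).
  by field; rewrite fact_neq0 !poch_neq0.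
rewrite poch_ratio // poch_opp c1E cnE pcD /d.
set P := \prod_(j < k) _.
rewrite [b * n%:R * (_ * P)]mulrA -mulrDl -summand_split //.
rewrite (_ : k.*2%:R = 2 * k%:R :> F); last by rewrite -mul2n natrM.
field; by rewrite signr_eq0 pck'0 pck0 ck0 c0 cn0 b0 cbn0.
Qed.

Lemma pFq_summation a b c n (d := (c + b * n%:R) / (1 - 2 * b)) :
  (forall l, l \in [:: 1 / 2; d; c + 1; 1 - c - n%:R] -> ~ nonpos_int l) ->
  1 - 2 * b != 0 -> c + b * n%:R != 0 -> a + c != 0 -> c - a != 0 ->
  poch c n != 0 ->
  pFq [:: - (n%:R / 2); (1 - n%:R) / 2; 1 + d; - a; a]
      [:: 1 / 2; d; c + 1; 1 - c - n%:R] 1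
  = c * (c + a + b * n%:R) / (2 * (c + b * n%:R) * (a + c))
      * (poch (c + a) n / poch c n)
    + c * (c - a + b * n%:R) / (2 * (c + b * n%:R) * (c - a))
      * (poch (c - a) n / poch c n).
Proof.
move=> h_lower b0 cbn0 apc0 cma0 cn0.
have c0 : c != 0.
  case: n cn0 cbn0 {d h_lower} => [|n]; first by rewrite mulr0 addr0.
  by rewrite pochSl mulf_eq0 negb_or => /andP[].
have termE k := pFq_term_summand a b c n k h_lower b0 cbn0 c0 cn0.
rewrite (pFq_finite _ _ _ n.+1); last first.
  by move=> k lt_nk; rewrite termE !bin_small; [ring|lia..].
transitivity (c / ((c + b * n%:R) * poch c n)
    * (stirling_sum a c n n.+1 + b * n%:R * stirling_sum a (c + 1) n.-1 n.+1)).
  rewrite /stirling_sum mulr_sumr -big_split mulr_sumr.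
  by apply: eq_bigr => k _; rewrite termE.
have two0 : (2 : F) != 0 by rewrite pnatr_eq0.
have -> : stirling_sum a c n n.+1 = (poch (c + a) n + poch (c - a) n) / 2.
  rewrite -(stirling_sum_poch a c n n.+1); last by lia.
  by rewrite mulrAC mulfV ?mul1r.
have -> : stirling_sum a (c + 1) n.-1 n.+1
    = (poch (c + 1 + a) n.-1 + poch (c + 1 - a) n.-1) / 2.
  rewrite -(stirling_sum_poch a (c + 1) n.-1 n.+1); last by lia.
  by rewrite mulrAC mulfV ?mul1r.
case: n cn0 cbn0 {d h_lower termE} => [|n] cn0 cbn0.
  by rewrite !poch0; field; rewrite apc0 cma0 c0.
rewrite /= (pochSl (c + a)) (pochSl (c - a)).
rewrite (addrAC c 1 a) (addrAC c 1 (- a)).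
move: (n.+1%:R : F) cbn0 => m cbn0; field.
by rewrite apc0 cma0 cn0 cbn0.
Qed.
End RisingFactorial.

Theorem proposition5p1 (R : realType) (n : nat) (a b c : R[i])
  (h_lower : forall l : R[i],
     l \in [:: 1 / 2; (c + b * n%:R) / (1 - 2 * b); c + 1; 1 - c - n%:R] ->
     ~ nonpos_int l)
  (h_12b : 1 - 2 * b != 0)
  (h_cbn : c + b * n%:R != 0)
  (h_apc : a + c != 0)
  (h_cma : c - a != 0)
  (h_cn : poch c n != 0) :
  pFq [:: - (n%:R / 2); (1 - n%:R) / 2; 1 + (c + b * n%:R) / (1 - 2 * b); - a; a]
      [:: 1 / 2; (c + b * n%:R) / (1 - 2 * b); c + 1; 1 - c - n%:R] 1
  = c * (c + a + b * n%:R) / (2 * (c + b * n%:R) * (a + c))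
      * (poch (c + a) n / poch c n)
    + c * (c - a + b * n%:R) / (2 * (c + b * n%:R) * (c - a))
      * (poch (c - a) n / poch c n).
Proof.
by apply: pFq_summation.
Qed.
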